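(* Let $\mathbf{A}$ be a semilattice. Then the posets $\langle \mathrm{Id}(\mathbf{A}),\subseteq\rangle$ and $\langle\mathcal{Z}(X(\mathbf{A})),\subseteq\rangle$ are dually isomorphic.
   Context: A semilattice is a meet-semilattice with top. $\mathrm{Id}(\mathbf{A})$ is the set of order-ideals (nonempty directed downsets) of $\mathbf{A}$. A proper filter $F$ is irreducible if $F=F_1\cap F_2$ for filters $F_1,F_2$ implies $F=F_1$ or $F=F_2$; $X(\mathbf{A})$ is the set of irreducible filters, $\beta(a)=\{P\in X(\mathbf{A})\colon a\in P\}$, $\mathcal{K}_\mathbf{A}=\{\beta(a)^c\colon a\in A\}$. $\mathcal{Z}(X(\mathbf{A}))$ is the set of subsets $Z\subseteq X(\mathbf{A})$ of the form $Z=\bigcap\mathcal{L}$ for some dually directed family $\mathcal{L}\subseteq\mathcal{K}_\mathbf{A}$ (i.e., for $U,V\in\mathcal{L}$ there is $W\in\mathcal{L}$ with $W\subseteq U\cap V$).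
   Formalization: Dually directed families are required to be nonempty; if the empty family were allowed, X(A) would always lie in Z(X(A)) and the claim would fail whenever A has no least element (e.g. an infinite descending chain with top). *)

(* Defs.v *)
From mathcomp Require Import all_boot all_order.
From mathcomp Require Import boolp classical_sets.

Set Implicit Arguments.
Unset Strict Implicit.
Unset Printing Implicit Defensive.

Local Open Scope classical_set_scope.

Section Semilattice.
Context {d : Order.disp_t} (A : tMeetSemilatticeType d).

Definition is_filter (F : set A) : Prop :=
  [/\ F Order.top,
      forall a b, F a -> (a <= b)%O -> F b
    & forall a b, F a -> F b -> F (Order.meet a b)].

Definition irreducible_filter (F : set A) : Prop :=
  [/\ is_filter F, F <> setT
    & forall F1 F2 : set A, is_filter F1 -> is_filter F2 ->
        F = F1 `&` F2 -> F = F1 \/ F = F2].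

Definition is_order_ideal (I : set A) : Prop :=
  [/\ I !=set0,
      forall a b, I b -> (a <= b)%O -> I a
    & forall a b, I a -> I b -> exists c, [/\ I c, (a <= c)%O & (b <= c)%O]].

Definition order_ideals : set (set A) := [set I | is_order_ideal I].

Definition irr_filters : set (set A) := [set P | irreducible_filter P].

(* irr_filters is coerced to the type of irreducible filters, so that the complement
   in Kfam is taken relative to irr_filters. *)
Definition beta (a : A) : set irr_filters := [set P | (val P : set A) a].

Definition Kfam : set (set irr_filters) := [set ~` beta a | a in [set: A]].

(* Directed families are nonempty, as in the definition of order-ideals: the
   intersection of the empty family would put the whole of irr_filters in
   Zfam, and Zfam would then have one element too many when A has no least
   element. *)
Definition dually_directed (L : set (set irr_filters)) : Prop :=
  L !=set0 /\
  forall U V, L U -> L V -> exists W, L W /\ W `<=` U `&` V.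

Definition Zfam : set (set irr_filters) :=
  [set S | exists L : set (set irr_filters),
     [/\ L `<=` Kfam, dually_directed L & S = \bigcap_(U in L) U]].

End Semilattice.

Arguments order_ideals {d} A _.
Arguments irr_filters {d} A _.
Arguments Kfam {d} A _.
Arguments Zfam {d} A _.

Definition dually_isomorphic (T U : Type)
    (P : set (set T)) (Q : set (set U)) : Prop :=
  exists f : P -> Q, bijective f /\
    forall I J : P,
      (val I : set T) `<=` val J <-> (val (f J) : set U) `<=` val (f I).

(* Main.v *)
(** An order-ideal [I] is sent to the set of irreducible filters disjoint from
    [I], which is the intersection of the dually directed family of the
    [~` beta a] for [a] in [I]. The map reflects the order because a filter
    containing [a] and maximal among those disjoint from an order-ideal [J] is
    irreducible, so every [a] outside [J] is separated from [J] by an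
    irreducible filter. Applied to principal ideals, the same separation shows
    that [beta a `<=` beta b] forces [a <= b], so the [b] indexing a dually
    directed family are directed and their downward closure is an order-ideal,
    the preimage of the given intersection. *)
Require Import Defs.
From mathcomp Require Import all_boot all_order.
From mathcomp Require Import boolp classical_sets.

Set Implicit Arguments.
Unset Strict Implicit.
Unset Printing Implicit Defensive.

Import Order.TTheory.
Local Open Scope classical_set_scope.

Section Separation.
Context {d : Order.disp_t} {A : tMeetSemilatticeType d}.
Implicit Types (a b : A) (F I J P : set A).

Lemma is_filter_principal a : is_filter [set x | (a <= x)%O].
Proof.
split=> [|x y /= ax xy|x y /= ax ay]; first exact: lex1.
  exact: le_trans xy.
by rewrite lexI ax.
Qed.

Lemma is_order_ideal_principal a : is_order_ideal [set x | (x <= a)%O].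
Proof.
split=> [|x y /= ya xy|x y /= xa ya]; first by exists a => /=.
  exact: le_trans ya.
by exists a; split.
Qed.

(** If [P] is the intersection of two filters that both meet [J], say at [x] and [y], an upper bound
    of [x] and [y] in [J] lies in both filters, hence in [P]. So one of them misses [J] and equals
    [P] by maximality. *)
Lemma irreducible_filter_maximal_disjoint J P :
  is_order_ideal J -> is_filter P -> P `&` J = set0 ->
  (forall F, is_filter F -> P `<=` F -> F `&` J = set0 -> F = P) ->
  irreducible_filter P.
Proof.
move=> [[j Jj] _ dirJ] filP PJ0 maxP; split=> // [PT|F1 F2 fil1 fil2 PF].
  by have [] : set0 j by rewrite -PJ0 PT.
have [F1J0|/set0P[x [F1x Jx]]] := eqVneq (F1 `&` J) set0.
  by left; rewrite (maxP F1) // PF; apply: subIsetl.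
have [F2J0|/set0P[y [F2y Jy]]] := eqVneq (F2 `&` J) set0.
  by right; rewrite (maxP F2) // PF; apply: subIsetr.
have [c [Jc xc yc]] := dirJ _ _ Jx Jy.
suff: (P `&` J) c by rewrite PJ0.
case: fil1 fil2 => _ up1 _ [_ up2 _].
by split=> //; rewrite PF; split; [apply: up1 xc | apply: up2 yc].
Qed.

Lemma irreducible_filter_separation J a : is_order_ideal J -> ~ J a ->
  exists P, [/\ irreducible_filter P, P a & P `&` J = set0].
Proof.
move=> idJ Ja; have [_ downJ _] := idJ.
(* [a] is only required in nonempty sets, because [Zorn_bigcup] also asks for
   the union of the empty chain. *)
pose Q F := [/\ F !=set0 -> F a,
  forall x y, F x -> (x <= y)%O -> F y,
  forall x y, F x -> F y -> F (Order.meet x y) & F `&` J = set0].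
have Qprincipal : Q [set x | (a <= x)%O].
  have [_ up meet] := is_filter_principal a; split=> //=.
  by apply/seteqP; split=> // x [/= ax /downJ/(_ ax)].
have [|P [[aP upP meetP PJ0] maxP]] := @Zorn_bigcup A Q.
  move=> C QC totC; split=> [[x [F CF Fx]]|x y [F CF Fx] xy||].
  - by exists F => //; have [aF _ _ _] := QC _ CF; apply: aF; exists x.
  - by exists F => //; have [_ upF _ _] := QC _ CF; apply: upF xy.
  - move=> x y [F CF Fx] [G CG Gy].
    have [_ _ meetF _] := QC _ CF; have [_ _ meetG _] := QC _ CG.
    have [FG|GF] := totC _ _ CF CG.
      by exists G => //; apply: meetG => //; apply: FG.
    by exists F => //; apply: meetF => //; apply: GF.
  - apply/seteqP; split=> // x [[F CF Fx] Jx].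
    by have [_ _ _ <-] := QC _ CF.
(* The empty set satisfies [Q], but it is not maximal: the principal filter of [a] is strictly
   larger. *)
have Pa : P a.
  apply: aP; apply/set0P/eqP => P0; apply: (maxP _ _ Qprincipal).
  by rewrite P0; split=> // /(_ a); apply=> /=.
have filP : is_filter P by split=> //; apply: upP Pa (lex1 a).
exists P; split=> //; apply: irreducible_filter_maximal_disjoint idJ _ _ _ => //.
(* A filter above [P] contains [a] automatically, so maximality within [Q] is maximality among all
   filters disjoint from [J]. *)
move=> F [_ upF meetF] PF FJ0; apply: contrapT => FP.
have QF : Q F by split=> // _; apply: PF.
apply: (maxP F _ QF); split=> // FsubP.
by apply: FP; apply/seteqP.
Qed.

Lemma le_of_beta_sub a b : beta a `<=` beta b -> (a <= b)%O.
Proof.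
move=> ab; apply: contrapT => nab.
have [P [irrP Pa Pb0]] :=
  irreducible_filter_separation (is_order_ideal_principal b) nab.
have Pb : beta b (exist _ P (mem_set irrP)) by apply: ab.
by have [] : set0 b by rewrite -Pb0; split=> /=.
Qed.

Definition disjoint_irr_filters I : set (irr_filters A) :=
  \bigcap_(a in I) ~` beta a.

Lemma disjoint_irr_filters_Zfam I :
  is_order_ideal I -> Zfam A (disjoint_irr_filters I).
Proof.
move=> [[i Ii] _ dirI]; exists [set ~` beta a | a in I]; split.
- by move=> _ [a _ <-]; exists a.
- split; first by exists (~` beta i), i.
  move=> _ _ [a Ia <-] [b Ib <-]; have [c [Ic ac bc]] := dirI _ _ Ia Ib.
  exists (~` beta c); split; first by exists c.
  move=> P nPc; have [[_ upP _] _ _] := set_mem (valP P).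
  by split=> [Pa|Pb]; apply: nPc; [apply: upP ac | apply: upP bc].
- by rewrite bigcap_image.
Qed.

Lemma disjoint_irr_filters_subset I J : is_order_ideal J ->
  I `<=` J <-> disjoint_irr_filters J `<=` disjoint_irr_filters I.
Proof.
move=> idJ; split=> [IJ P PJ a /IJ Ja|JI a Ia]; first exact: PJ.
apply: contrapT => nJa.
have [P [irrP Pa PJ0]] := irreducible_filter_separation idJ nJa.
apply: (JI (exist _ P (mem_set irrP)) _ a Ia Pa) => b Jb Pb.
by have [] : set0 b by rewrite -PJ0.
Qed.

Lemma Zfam_disjoint_irr_filters S : Zfam A S ->
  exists2 I, is_order_ideal I & disjoint_irr_filters I = S.
Proof.
move=> [L [LK [[U LU] dirL] ->]].
exists [set a | exists2 b, L (~` beta b) & (a <= b)%O].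
  split=> [|a b [c Lc bc] ab|a b [a' La aa'] [b' Lb bb']].
  - by have [a _ aU] := LK _ LU; exists a, a; rewrite ?aU.
  - by exists c => //; apply: le_trans bc.
  - have [W [LW Wab]] := dirL _ _ La Lb; have [c _ cW] := LK _ LW.
    rewrite -cW in LW Wab; exists c; split; first by exists c.
    + apply: le_trans aa' _; apply: le_of_beta_sub; rewrite -setCS.
      by move=> P /Wab[].
    + apply: le_trans bb' _; apply: le_of_beta_sub; rewrite -setCS.
      by move=> P /Wab[].
apply/seteqP; split=> P PI.
  move=> V LV; have [a _ aV] := LK _ LV; rewrite -aV in LV *.
  by apply: PI; exists a.
(* Filters are upward closed, so a filter avoiding every index [b] also avoids everything below
   one. *)
move=> a [b Lb ab] Pa; have [[_ upP _] _ _] := set_mem (valP P).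
by apply: (PI _ Lb); apply: upP ab.
Qed.

End Separation.

Theorem theorem5 (d : Order.disp_t) (A : tMeetSemilatticeType d) :
  dually_isomorphic (order_ideals A) (Zfam A).
Proof.
pose f (I : order_ideals A) : Zfam A := exist _ (disjoint_irr_filters (val I))
  (mem_set (disjoint_irr_filters_Zfam (set_mem (valP I)))).
have fP (I J : order_ideals A) : (val I : set A) `<=` val J <->
    (val (f J) : set (irr_filters A)) `<=` val (f I).
  exact: disjoint_irr_filters_subset (set_mem (valP J)).
have f_inj : injective f.
  move=> I J fIJ; apply: val_inj; apply/seteqP.
  by split; apply/fP; rewrite fIJ.
have f_surj (Z : Zfam A) : exists I, f I = Z.
  have [I idI IZ] := Zfam_disjoint_irr_filters (set_mem (valP Z)).
  by exists (exist _ I (mem_set idI)); apply: val_inj.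
(* A chosen right inverse of the injective [f] is also a left inverse. *)
have [g fK] := choice f_surj.
by exists f; split=> //; exists g => // I; apply: f_inj; rewrite fK.
Qed.
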